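(* Let $0<\mu\le L$ with $\kappa=L/\mu\ge4$, $f\in S_{\mu,L}(\mathbb{R}^d)$, $\sigma,\eta\ge0$, and $$\bar\alpha=\begin{cases}\min\left\{\frac1L,\frac{\mu^3}{(60\eta^2)^2}\right\}&\text{if }\eta>0,\\ \frac1L&\text{if }\eta=0.\end{cases}$$ Let $\alpha\in(0,\bar\alpha]$ and $\beta=\frac{1-\sqrt{\alpha\mu}}{1+\sqrt{\alpha\mu}}$. Consider the ASG iterations, for $k\ge0$, $$y_k=(1+\beta)x_k-\beta x_{k-1},\qquad x_{k+1}=y_k-\alpha\tilde\nabla f(y_k,w_k),$$ with state $\xi_k=[x_k^\top\ x_{k-1}^\top]^\top$, under the noise model $\mathbb{E}[\tilde\nabla f(y_k,w_k)\mid y_k]=\nabla f(y_k)$ and $\mathbb{E}[\|\tilde\nabla f(y_k,w_k)-\nabla f(y_k)\|^2\mid y_k]\le\sigma^2+\eta^2\|y_k-x^*\|^2$. Then for every $k\ge0$, $$\mathbb{E}[V_{Q_\alpha}(\xi_{k+1})]\le\Big(1-\frac{\sqrt{\alpha\mu}}{3}\Big)\mathbb{E}[V_{Q_\alpha}(\xi_k)]+2\sigma^2\alpha,$$ where $Q_\alpha=\tilde Q_\alpha\otimes I_d$ with $$\tilde Q_\alpha=\begin{bmatrix}\sqrt{\frac{1}{2\alpha}}\\ \sqrt{\frac\mu2}-\sqrt{\frac1{2\alpha}}\end{bmatrix}\begin{bmatrix}\sqrt{\frac{1}{2\alpha}}& \sqrt{\frac\mu2}-\sqrt{\frac1{2\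alpha}}\end{bmatrix}+2\alpha\eta^2\begin{bmatrix}1+\beta\\-\beta\end{bmatrix}\begin{bmatrix}1+\beta&-\beta\end{bmatrix}.$$
   Context: $S_{\mu,L}(\mathbb{R}^d)$ is the set of continuously differentiable $f:\mathbb{R}^d\to\mathbb{R}$ with $\frac{\mu}{2}\|x-y\|^2\le f(x)-f(y)-\nabla f(y)^\top(x-y)\le\frac L2\|x-y\|^2$ for all $x,y$. $x^*$ is the unique minimizer of $f$, $f^*=f(x^* )$, $\xi^*=[{x^*}^\top\ {x^*}^\top]^\top$. For a symmetric positive semidefinite $P\in\mathbb{R}^{2d\times2d}$, $V_P(\xi)=(\xi-\xi^* )^\top P(\xi-\xi^* )+f(T\xi)-f^*$ with $T=[I_d\ \ 0_d]$ (so $T\xi_k=x_k$). $\otimes$ is the Kronecker product. The $w_k$ are independent random variables, $w_k$ being independent of the initial points and of $w_0,\dots,w_{k-1}$. The initial points $x_0,x_{-1}$ (possibly random) have finite second moments. *)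

(* Defs.v *)
From HB Require Import structures.
From mathcomp Require Import all_boot all_order all_algebra.
From mathcomp Require Import all_classical all_reals all_analysis.
From mathcomp Require Import measurable_realfun random_variable.

Set Implicit Arguments.
Unset Strict Implicit.
Unset Printing Implicit Defensive.

Import Order.TTheory GRing.Theory Num.Theory.
Import numFieldNormedType.Exports.

Local Open Scope classical_set_scope.
Local Open Scope ring_scope.

(* The norm that MathComp-Analysis puts on matrices is the sup norm; it has the
   Euclidean topology (hence the same continuity and differentiability), but
   the Euclidean norm itself has to be spelled out. *)
Definition sqnorm (R : realType) (d : nat) (v : 'cV[R]_d) : R :=
  \sum_(i < d) v i ord0 ^+ 2.

Definition grad (R : realType) (d : nat) (f : 'cV[R]_d -> R) (x : 'cV[R]_d) :
    'cV[R]_d :=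
  \col_(i < d) 'D_(delta_mx i ord0) f x.

Definition continuously_differentiable (R : realType) (d : nat)
    (f : 'cV[R]_d -> R) : Prop :=
  (forall x, differentiable f x) /\ continuous (grad f).

(* The class S_{mu,L}(R^d). *)
Definition smooth_strongly_convex (R : realType) (d : nat) (mu L : R)
    (f : 'cV[R]_d -> R) : Prop :=
  continuously_differentiable f /\
  forall x y : 'cV[R]_d,
    let gap := f x - f y - ((grad f y)^T *m (x - y)) ord0 ord0 in
    mu / 2 * sqnorm (x - y) <= gap /\ gap <= L / 2 * sqnorm (x - y).

Definition unique_minimizer (R : realType) (d : nat)
    (f : 'cV[R]_d -> R) (x : 'cV[R]_d) : Prop :=
  forall z : 'cV[R]_d, z <> x -> f x < f z.

Definition borelV (R : realType) (d : nat) :=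
  g_sigma_algebraType (@open 'cV[R]_d).

(* Kronecker product of a 2 x 2 matrix with a d x d matrix. *)
Definition kron2 (R : realType) (d : nat) (A : 'M[R]_2) (B : 'M[R]_d) :
    'M[R]_(d + d) :=
  block_mx (A ord0 ord0 *: B) (A ord0 ord_max *: B)
           (A ord_max ord0 *: B) (A ord_max ord_max *: B).

Definition col2 (R : realType) (a b : R) : 'cV[R]_2 :=
  \col_(i < 2) if i == ord0 then a else b.

Section ASG.
Context (R : realType) (d : nat).
Implicit Types (alpha beta mu L eta : R) (xi : 'cV[R]_(d + d)).

Definition alpha_bar mu L eta : R :=
  if 0 < eta then Num.min (1 / L) (mu ^+ 3 / (60 * eta ^+ 2) ^+ 2) else 1 / L.

Definition momentum alpha mu : R :=
  (1 - Num.sqrt (alpha * mu)) / (1 + Num.sqrt (alpha * mu)).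

Definition Qtilde alpha beta mu eta : 'M[R]_2 :=
  let u := col2 (Num.sqrt (1 / (2 * alpha)))
                (Num.sqrt (mu / 2) - Num.sqrt (1 / (2 * alpha))) in
  let v := col2 (1 + beta) (- beta) in
  u *m u^T + (2 * alpha * eta ^+ 2) *: (v *m v^T).

Definition Qmx alpha beta mu eta : 'M[R]_(d + d) :=
  kron2 (Qtilde alpha beta mu eta) 1%:M.

(* T = [I_d 0_d], so that Tmx *m col_mx x x' = x. *)
Definition Tmx : 'M[R]_(d, d + d) := row_mx 1%:M 0.

Definition lyapunov (P : 'M[R]_(d + d)) (f : 'cV[R]_d -> R) (xs : 'cV[R]_d)
    xi : R :=
  let e := xi - col_mx xs xs in
  (e^T *m P *m e) ord0 ord0 + f (Tmx *m xi) - f xs.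

(* A state is xi_k = [x_k; x_{k-1}]: usubmx is x_k and dsubmx is x_{k-1}. *)
Definition extrapolate beta xi : 'cV[R]_d :=
  (1 + beta) *: usubmx xi - beta *: dsubmx xi.

(* xi_k for a realization w of the noise sequence; g (y, w) is the stochastic
   gradient at y. *)
Fixpoint asg_state (W : Type) alpha beta (g : 'cV[R]_d * W -> 'cV[R]_d)
    (x0 xm1 : 'cV[R]_d) (w : nat -> W) (k : nat) : 'cV[R]_(d + d) :=
  if k is k'.+1 then
    let xi := asg_state alpha beta g x0 xm1 w k' in
    let y := extrapolate beta xi in
    col_mx (y - alpha *: g (y, w k')) (usubmx xi)
  else col_mx x0 xm1.

End ASG.

Section Probability.
Local Open Scope ereal_scope.
Context (R : realType) (dT : measure_display) (T : measurableType dT).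
Variable P : probability T R.

Definition independent (F G : set (set T)) : Prop :=
  forall A B, F A -> G B -> P (A `&` B) = P A * P B.

(* Z is a version of E[X | Y], for X integrable or nonnegative (in the latter
   case Z may take the value +oo). *)
Definition is_condexp (dS : measure_display) (S : measurableType dS)
    (Y : T -> S) (X Z : T -> \bar R) : Prop :=
  [/\ P.-integrable [set: T] X \/
        (measurable_fun [set: T] X /\ forall t, 0 <= X t),
      measurable_fun [set: g_sigma_algebra_preimageType Y]
        (Z : g_sigma_algebra_preimageType Y -> \bar R) &
      forall A, g_sigma_algebra_preimage Y A ->
        \int[P]_(t in A) Z t = \int[P]_(t in A) X t].

(* The sigma-algebra of (x_0, x_{-1}, w_0, ..., w_{k-1}). *)
Definition past (d : nat) (dW : measure_display) (W : measurableType dW)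
    (x0 xm1 : T -> borelV R d) (w : nat -> T -> W) (k : nat) : set (set T) :=
  <<s g_sigma_algebra_preimage x0 `|` g_sigma_algebra_preimage xm1 `|`
      \bigcup_(j in `I_k) g_sigma_algebra_preimage (w j) >>.

Definition finite_second_moment (d : nat) (X : T -> 'cV[R]_d) : Prop :=
  'E_P[fun t => sqnorm (X t)] < +oo.

(* E[G | Y] = grad f(Y) (componentwise) and
   E[|G - grad f(Y)|^2 | Y] <= sigma^2 + eta^2 |Y - xs|^2 almost surely. *)
Definition noise_model (d : nat) (f : 'cV[R]_d -> R) (xs : 'cV[R]_d)
    (sigma eta : R) (Y : T -> borelV R d) (G : T -> 'cV[R]_d) : Prop :=
  (forall i : 'I_d,
     is_condexp Y (fun t => (G t i ord0)%:E)
       (fun t => (grad f (Y t) i ord0)%:E)) /\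
  exists Z : T -> \bar R,
    is_condexp Y (fun t => (sqnorm (G t - grad f (Y t)))%:E) Z /\
    {ae P, forall t,
       Z t <= (sigma ^+ 2 + eta ^+ 2 * sqnorm ((Y t : 'cV[R]_d) - xs))%:E}.

End Probability.

(* Main.v *)
From HB Require Import structures.
Require Import Defs.
From mathcomp Require Import all_boot all_order all_algebra.
From mathcomp Require Import all_classical all_reals all_analysis.
From mathcomp Require Import measurable_realfun random_variable.
From mathcomp Require Import ring lra.
Import Order.TTheory GRing.Theory Num.Theory.
Import numFieldNormedType.Exports.
Local Open Scope classical_set_scope.
Local Open Scope ring_scope.

(** Put s = sqrt(alpha mu), X = x_k - xs, Y = y_k - xs, g = grad f(y_k), and let
n be the gradient noise at y_k. Since 1 - s = beta (1 + s), the Lyapunov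
function is |(1+s) Y - X|^2 / (2 alpha) + 2 alpha eta^2 |Y|^2 + f(x_k) - f(xs).
For n = 0 its part without eta contracts by 1 - s, by strong convexity at y_k
(applied to x_k and to xs) and the descent lemma; the constant 60 in the step
size makes 2 alpha eta^2 |y_{k+1} - xs|^2 at most 2s/3 times that part. The
noise adds a cross term <n, M>, with M a function of the state, and
c (|n|^2 - eta^2 |Y|^2) with c <= 2 alpha. The noise hypothesis only conditions
on y_k, whereas M also depends on x_k: by independence of w_k and Fubini,
E[n | state] = h(y_k) with h(v) = E[g(v, w_k)] - grad f(v), and testing against
events of sigma(y_k) gives h(y_k) = 0 almost surely, so E<n, M> = 0. *)

(** * Euclidean inner product and quadratic forms *)

Definition dot {R : realType} {d : nat} (u v : 'cV[R]_d) : R :=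
  \sum_(i < d) u i ord0 * v i ord0.

Section dot.
Context {R : realType} {d : nat}.
Implicit Types (u v w : 'cV[R]_d) (a b : R).

Lemma dotE u v : (u^T *m v) ord0 ord0 = dot u v.
Proof. by rewrite mxE; apply: eq_bigr => i _; rewrite mxE. Qed.

Lemma sqnormE u : sqnorm u = dot u u.
Proof. by apply: eq_bigr => i _; rewrite expr2. Qed.

Lemma dotC u v : dot u v = dot v u.
Proof. by apply: eq_bigr => i _; rewrite mulrC. Qed.

Lemma dotDl u v w : dot (u + v) w = dot u w + dot v w.
Proof. by rewrite -big_split; apply: eq_bigr => i _; rewrite mxE mulrDl. Qed.

Lemma dotDr u v w : dot w (u + v) = dot w u + dot w v.
Proof. by rewrite dotC dotDl !(dotC w). Qed.

Lemma dotZl a u v : dot (a *: u) v = a * dot u v.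
Proof. by rewrite mulr_sumr; apply: eq_bigr => i _; rewrite mxE mulrA. Qed.

Lemma dotZr a u v : dot v (a *: u) = a * dot v u.
Proof. by rewrite dotC dotZl dotC. Qed.

Lemma dotNl u v : dot (- u) v = - dot u v.
Proof. by rewrite -scaleN1r dotZl mulN1r. Qed.

Lemma dotNr u v : dot v (- u) = - dot v u.
Proof. by rewrite dotC dotNl dotC. Qed.

Definition dot_lin := (dotDl, dotDr, dotNl, dotNr, dotZl, dotZr).

Lemma dot_ge0 u : 0 <= dot u u.
Proof. by apply: sumr_ge0 => i _; rewrite -expr2 sqr_ge0. Qed.

Lemma dot_le0 u : dot u u <= 0 -> u = 0.
Proof.
move=> u0; apply/colP => i; rewrite mxE.
have /eqP : dot u u = 0 by apply/le_anti; rewrite u0 dot_ge0.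
rewrite psumr_eq0 => [/allP/(_ i)|j _]; last by rewrite -expr2 sqr_ge0.
by rewrite mem_index_enum -expr2 sqrf_eq0 => /(_ isT)/eqP.
Qed.

Lemma coord_sq_le u i : u i ord0 ^+ 2 <= dot u u.
Proof.
rewrite /dot (bigD1 i)//= -expr2 lerDl; apply: sumr_ge0 => j _.
by rewrite -expr2 sqr_ge0.
Qed.

Lemma dot_add_le u v : dot (u + v) (u + v) <= 2 * dot u u + 2 * dot v v.
Proof.
by have := dot_ge0 (u - v); rewrite !dot_lin (dotC v u); lra.
Qed.

(** The difference of the two sides is |au + bv|^2 + |au - cw|^2 + |bv + cw|^2. *)
Lemma dot_comb3_le a b c u v w :
  dot (a *: u - b *: v + c *: w) (a *: u - b *: v + c *: w) <=
  3 * (a ^+ 2 * dot u u) + 3 * (b ^+ 2 * dot v v) + 3 * (c ^+ 2 * dot w w).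
Proof.
have h1 := dot_ge0 (a *: u + b *: v); have h2 := dot_ge0 (a *: u - c *: w).
have h3 := dot_ge0 (b *: v + c *: w); move: h1 h2 h3.
by rewrite !dot_lin (dotC v u) (dotC w u) (dotC w v) !expr2; lra.
Qed.

Lemma kron2_form (A : 'M[R]_2) u v :
  ((col_mx u v)^T *m kron2 A 1%:M *m col_mx u v) ord0 ord0 =
  A ord0 ord0 * dot u u + A ord0 ord_max * dot u v +
  A ord_max ord0 * dot v u + A ord_max ord_max * dot v v.
Proof.
rewrite tr_col_mx mul_row_block mul_row_col !mulmxDl -!scalemxAr !mulmx1.
have trE (a b : 'cV[R]_d) : \sum_j a^T ord0 j * b j ord0 = dot a b.
  by rewrite -dotE mxE.
by rewrite -!scalemxAl !mxE !trE; lra.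
Qed.

End dot.

(** * Smooth strongly convex functions near their minimizer *)

Section smooth.
Context {R : realType} {d : nat} {mu L : R} {f : 'cV[R]_d -> R} {xs : 'cV[R]_d}.
Hypotheses (mu0 : 0 < mu) (muL : mu <= L).
Hypotheses (hf : smooth_strongly_convex mu L f) (hxs : unique_minimizer f xs).

Lemma smooth_ub x y :
  f x <= f y + dot (grad f y) (x - y) + L / 2 * dot (x - y) (x - y).
Proof. by have [_ /(_ x y)[_]] := hf; rewrite dotE sqnormE; lra. Qed.

Lemma strong_lb x y :
  f y + dot (grad f y) (x - y) + mu / 2 * dot (x - y) (x - y) <= f x.
Proof. by have [_ /(_ x y)[+ _]] := hf; rewrite dotE sqnormE; lra. Qed.

Lemma min_le z : f xs <= f z.
Proof. by have [->//|/eqP/hxs/ltW] := eqVneq z xs. Qed.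

(** The minimum lies below the value after a gradient step of length 1/L, and smoothness bounds that
    value by f(y) - |grad f(y)|^2 / (2L). *)
Lemma grad_sq_le y : dot (grad f y) (grad f y) <= 2 * L * (f y - f xs).
Proof.
have L0 : 0 < L by exact: lt_le_trans muL.
have Ln0 : L != 0 by exact: lt0r_neq0.
have := smooth_ub (y - L^-1 *: grad f y) y.
have := min_le (y - L^-1 *: grad f y).
rewrite [_ - y](_ : _ = - (L^-1 *: grad f y)); last by rewrite addrC addKr.
rewrite !dot_lin.
set D := dot _ _ => h1 h2.
have : f xs <= f y - D / (2 * L).
  apply: (le_trans h1); apply: (le_trans h2).
  by rewrite le_eqVlt; apply/orP; left; apply/eqP; field.
have -> : D = 2 * L * (D / (2 * L)) by field.
by move=> h; rewrite ler_pM2l; [lra|lra].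
Qed.

(** At [xs] the bound of [grad_sq_le] is zero, so first-order optimality follows without computing a
    derivative. *)
Lemma grad_min : grad f xs = 0.
Proof. by apply: dot_le0; have := grad_sq_le xs; rewrite subrr mulr0. Qed.

Lemma gap_ub x : f x - f xs <= L / 2 * dot (x - xs) (x - xs).
Proof.
have := smooth_ub x xs.
(* The zero vector is written [0 *: 0] so that [dotZl] makes the inner product vanish. *)
by rewrite grad_min -(scale0r 0) dotZl mul0r addr0; lra.
Qed.

Lemma gap_lb x : mu / 2 * dot (x - xs) (x - xs) <= f x - f xs.
Proof.
have := strong_lb x xs.
by rewrite grad_min -(scale0r 0) dotZl mul0r addr0; lra.
Qed.

End smooth.

(** * One-step inequality along a fixed realization *)

(* A, B, C, E, F stand for |X|^2, <X, Y>, |Y|^2, <g, X>, <g, Y>, and i for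
   1 / (2 alpha), so that mu / 2 = s^2 i. *)
Lemma potential_decrease {R : realFieldType} {s i A B C E F fy fx : R} :
  0 <= s -> s <= 1 -> 0 < i -> 0 <= A - 2 * B + C ->
  fy <= F - s ^+ 2 * i * C ->
  fy - fx <= F - E - s ^+ 2 * i * (A - 2 * B + C) ->
  i * (C - 2 * (1 - s) * B + (1 - s) ^+ 2 * A) - F + (1 - s) * E + fy <=
  (1 - s) * (i * ((1 + s) ^+ 2 * C - 2 * (1 + s) * B + A) + fx).
Proof.
move=> s0 s1 i0 ABC h1 h2.
(* Certificate: weight [s] on the inequality coming from xs, weight [1 - s] on the one coming from
   x_k, plus a nonnegative multiple of |X - Y|^2. The three terms add up exactly to the difference
   of the two sides. *)
have k1 : 0 <= s * (F - s ^+ 2 * i * C - fy) by apply: mulr_ge0; lra.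
have k2 : 0 <= (1 - s) * (F - E - s ^+ 2 * i * (A - 2 * B + C) - (fy - fx)).
  by apply: mulr_ge0; lra.
have k3 : 0 <= s * (1 - s) * (1 + s) * i * (A - 2 * B + C).
  by rewrite !mulr_ge0//; lra.
rewrite -subr_ge0; apply: (le_trans (addr_ge0 (addr_ge0 k1 k2) k3)).
by rewrite le_eqVlt; apply/orP; left; apply/eqP; ring.
Qed.

(** |pu - qv|^2 <= 2 p^2 |u|^2 + 2 q^2 |v|^2 <= 8 |u|^2 + 2 |v|^2, and each squared norm is at most
    2K / mu, whence 16 + 4 = 20. *)
Lemma dot_comb_le {R : realType} {d : nat} (mu p q K : R) (u v : 'cV[R]_d) :
  0 < mu -> 0 <= p -> p <= 2 -> 0 <= q -> q <= 1 ->
  mu / 2 * dot u u <= K -> mu / 2 * dot v v <= K ->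
  dot (p *: u - q *: v) (p *: u - q *: v) <= 20 / mu * K.
Proof.
move=> mu0 p0 p2 q0 q1 hu hv.
have p4 : p * p <= 4 by nra.
have q4 : q * q <= 1 by nra.
have := dot_ge0 (p *: u + q *: v); rewrite !dot_lin (dotC v u) => h.
have k1 := ler_wpM2r (dot_ge0 u) p4.
have k2 := ler_wpM2r (dot_ge0 v) q4.
rewrite mulrAC ler_pdivlMr//.
have k : p * (p * dot u u) + - (q * (p * dot u v)) +
    (- (p * (q * dot u v)) + - - (q * (q * dot v v))) <=
  8 * dot u u + 2 * dot v v by lra.
by have := ler_wpM2r (ltW mu0) k; lra.
Qed.

Section step.
Context {R : realType} {d : nat} {mu L : R} {f : 'cV[R]_d -> R} {xs : 'cV[R]_d}.
Context {eta alpha s beta : R}.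
Hypotheses (mu0 : 0 < mu) (muL : mu <= L).
Hypotheses (hf : smooth_strongly_convex mu L f) (hxs : unique_minimizer f xs).
Hypotheses (alpha0 : 0 < alpha) (s0 : 0 < s) (s_half : s <= 2^-1).
Hypothesis (s2 : s ^+ 2 = alpha * mu).
Hypothesis (alphaL : alpha * L <= 1).
Hypothesis (alpha_eta : alpha * eta ^+ 2 <= s * mu / 60).
Hypothesis (betaE : beta = (1 - s) / (1 + s)).

(* The first rank-one term of Qtilde is the square of (1, s - 1) / sqrt (2 alpha). *)
Definition potential (xi : 'cV[R]_(d + d)) : R :=
  let u := usubmx xi - xs - (1 - s) *: (dsubmx xi - xs) in
  let v := extrapolate beta xi - xs in
  (2 * alpha)^-1 * dot u u + 2 * alpha * eta ^+ 2 * dot v v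
  + (f (usubmx xi) - f xs).

Lemma lyapunovE xi : lyapunov (Qmx d alpha beta mu eta) f xs xi = potential xi.
Proof.
rewrite /lyapunov /potential /Tmx -{1 2 3}[xi]vsubmxK mul_row_col mul1mx mul0mx addr0.
rewrite opp_col_mx add_col_mx kron2_form -addrA; congr (_ + _).
rewrite /extrapolate /Qtilde.
have -> : (1 + beta) *: usubmx xi - beta *: dsubmx xi - xs =
  (1 + beta) *: (usubmx xi - xs) - beta *: (dsubmx xi - xs).
  by apply/colP => i; rewrite !mxE; ring.
set u := usubmx xi - xs; set v := dsubmx xi - xs.
set a := Num.sqrt (1 / (2 * alpha)).
have a2 : a ^+ 2 = (2 * alpha)^-1.
  by rewrite sqr_sqrtr ?div1r// invr_ge0 mulr_ge0 ?ltW.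
have -> : Num.sqrt (mu / 2) = s * a.
  rewrite -[s in RHS]ger0_norm ?ltW// -sqrtr_sqr -sqrtrM ?sqr_ge0// s2.
  by congr Num.sqrt; field; exact: lt0r_neq0.
move: u v => u v; rewrite -a2 !dot_lin (dotC v u) !mxE !big_ord1 !mxE /=.
ring.
Qed.

(** Coefficient of |n|^2 in the bound on the new potential: alpha / 2 from the first square, alpha /
    2 from the descent lemma, the rest from the eta term. *)
Definition noise_coef : R :=
  alpha + 2 * alpha ^+ 3 * eta ^+ 2 * (1 + beta) ^+ 2.

Let e : R := 4 * alpha ^+ 2 * eta ^+ 2 * (1 + beta).

(** This is M = - U - e W, where U and W are the noiseless values of the two vectors squared in the
    new potential, regrouped along X, Y and g. The factor [e] comes from expanding 2 alpha eta^2 |W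
    - alpha (1 + beta) n|^2. *)
Definition cross_term (xi : 'cV[R]_(d + d)) : 'cV[R]_d :=
  let y := extrapolate beta xi in
  (1 - s + e * beta) *: (usubmx xi - xs) - (1 + e * (1 + beta)) *: (y - xs)
  + (alpha * (1 + e * (1 + beta))) *: grad f y.

Lemma s_lt1 : s < 1.
Proof. by apply: (le_lt_trans s_half); rewrite invf_lt1 ?ltr1n. Qed.

Lemma beta_bounds : 0 <= beta <= 1.
Proof.
have := s_lt1; move: (s0) => s0' s1.
by rewrite betaE; apply/andP; split; [apply: divr_ge0|rewrite ler_pdivrMr]; lra.
Qed.

(** alpha (alpha eta^2) <= s (alpha mu) / 60 = s^3 / 60, and s <= 1/2 gives 1 / (60 * 8). *)
Lemma alpha_eta2 : 480 * (alpha ^+ 2 * eta ^+ 2) <= 1.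
Proof.
have h1 : alpha ^+ 2 * eta ^+ 2 <= s ^+ 3 / 60.
  have := ler_wpM2l (ltW alpha0) alpha_eta.
  rewrite [leRHS](_ : _ = s * (alpha * mu) / 60); last by ring.
  by rewrite -s2 [leRHS](_ : _ = s ^+ 3 / 60); [rewrite mulrA -expr2|ring].
have h2 : s ^+ 3 <= 8^-1.
  have -> : 8^-1 = 2^-1 ^+ 3 :> R by field.
  by apply: lerXn2r; rewrite ?nnegrE ?invr_ge0// ltW.
lra.
Qed.

(** The coefficient is alpha (1 + q) with q = 2 alpha^2 eta^2 (1 + beta)^2, and 1 + beta <= 2 gives
    0 <= q <= 8 / 480 = 1 / 60. *)
Lemma noise_coef_bounds :
  alpha <= noise_coef /\ 60 * noise_coef <= 61 * alpha.
Proof.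
have [b0 b1] := andP beta_bounds.
have bb : (1 + beta) ^+ 2 <= 4.
  have -> : 4 = 2 ^+ 2 :> R by ring.
  by apply: lerXn2r; rewrite ?nnegrE//; lra.
have a2e : 0 <= alpha ^+ 2 * eta ^+ 2 by rewrite mulr_ge0 ?sqr_ge0.
have h : 240 * (2 * (alpha ^+ 2 * eta ^+ 2) * (1 + beta) ^+ 2) <= 4.
  have h1 := ler_wpM2l a2e bb.
  by have h2 := alpha_eta2; lra.
have h0 : 0 <= 2 * (alpha ^+ 2 * eta ^+ 2) * (1 + beta) ^+ 2.
  by apply: mulr_ge0; [apply: mulr_ge0|apply: sqr_ge0].
have cE : noise_coef =
  alpha * (1 + 2 * (alpha ^+ 2 * eta ^+ 2) * (1 + beta) ^+ 2).
  by rewrite /noise_coef; ring.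
rewrite cE; move: (2 * _ * _) h h0 => q h h0; split.
  by rewrite -[leLHS]mulr1 ler_pM2l//; lra.
by rewrite mulrCA [61 * _]mulrC ler_pM2l//; lra.
Qed.

(** A purely deterministic inequality: [G] is any vector. Taking expectations later removes the
    cross term and bounds the last one by the variance. *)
Lemma potential_step xi G y g n :
  y = extrapolate beta xi -> g = grad f y -> n = G - g ->
  potential (col_mx (y - alpha *: G) (usubmx xi)) <=
  (1 - s / 3) * potential xi + dot n (cross_term xi)
  + noise_coef * (dot n n - eta ^+ 2 * dot (y - xs) (y - xs)).
Proof.
move=> yE gE nE; have [b0 b1] := andP beta_bounds; have s1 := s_lt1.
rewrite /potential /cross_term -yE -gE col_mxKu col_mxKd.
have -> : G = g + n by rewrite nE addrC subrK.
set x := usubmx xi; set z := dsubmx xi.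
have s1n : 1 + s != 0 by rewrite lt0r_neq0// addr_gt0.
have -> : x - xs - (1 - s) *: (z - xs) = (1 + s) *: (y - xs) - (x - xs).
  rewrite yE /extrapolate -/x -/z betaE; apply/colP => i; rewrite !mxE.
  by field.
rewrite [extrapolate _ (col_mx _ _)]/extrapolate col_mxKu col_mxKd.
have -> : y - alpha *: (g + n) - xs - (1 - s) *: (x - xs) =
    (y - xs) - (1 - s) *: (x - xs) - alpha *: (g + n).
  by apply/colP => i; rewrite !mxE; ring.
have -> : (1 + beta) *: (y - alpha *: (g + n)) - beta *: x - xs =
    (1 + beta) *: ((y - xs) - alpha *: g) - beta *: (x - xs)
    - (alpha * (1 + beta)) *: n.
  by apply/colP => i; rewrite !mxE; ring.
have i0 : 0 < (2 * alpha)^-1 by rewrite invr_gt0 mulr_gt0.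
have alphaE : alpha = (2 * (2 * alpha)^-1)^-1.
  by field; rewrite lt0r_neq0.
have muE : mu / 2 = s ^+ 2 * (2 * alpha)^-1.
  by rewrite s2; field; rewrite lt0r_neq0.
(* Descent lemma with alpha L <= 1. The terms in <g, m> cancel, so the noise enters this bound only
   through |m|^2. *)
have h_up m : f (y - alpha *: (g + m)) <=
    f y - alpha / 2 * dot g g + alpha / 2 * dot m m.
  have := smooth_ub hf (y - alpha *: (g + m)) y.
  rewrite [_ - y](_ : _ = - (alpha *: (g + m))); last by rewrite addrC addKr.
  rewrite -gE !dotNl !dotNr opprK !dotZl !dotZr => /le_trans; apply.
  have La : L / 2 * (alpha * (alpha * dot (g + m) (g + m))) <=
      alpha / 2 * dot (g + m) (g + m).
    rewrite [leLHS](_ : _ = (alpha * L) * (alpha / 2 * dot (g + m) (g + m))).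
      rewrite ler_piMl// mulr_ge0 ?dot_ge0// divr_ge0// ltW//.
    by ring.
  move: La; rewrite !dotDl !dotDr (dotC m g); lra.
set X := x - xs; set Y := y - xs.
(* By [h_up] at 0, the left side dominates the potential without its eta term after a noiseless
   step. *)
have hd : (2 * alpha)^-1 * dot (Y - (1 - s) *: X - alpha *: g)
   (Y - (1 - s) *: X - alpha *: g) + (f y - f xs) - alpha / 2 * dot g g
   <= (1 - s) * ((2 * alpha)^-1 * dot ((1 + s) *: Y - X)
         ((1 + s) *: Y - X) + (f x - f xs)).
  have h1 : f y - f xs <= dot g Y - s ^+ 2 * (2 * alpha)^-1 * dot Y Y.
    have := strong_lb hf xs y.
    rewrite [xs - y](_ : _ = - Y); last by rewrite opprB.
    by rewrite muE -gE !dotNl !dotNr; lra.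
  have h2 : f y - f xs - (f x - f xs) <= dot g Y - dot g X - s ^+ 2 *
      (2 * alpha)^-1 * (dot X X - 2 * dot X Y + dot Y Y).
    have := strong_lb hf x y.
    rewrite [x - y](_ : _ = X - Y); last by rewrite opprB addrA subrK.
    clear h1; move: X Y => X Y; rewrite muE -gE !dot_lin (dotC Y X) => h.
    have -> : dot X X - 2 * dot X Y + dot Y Y =
      dot X X + - dot X Y + (- dot X Y + - - dot Y Y) by ring.
    by lra.
  have h3 : 0 <= dot X X - 2 * dot X Y + dot Y Y.
    have := dot_ge0 (X - Y); clear h1 h2; move: X Y => X Y.
    by rewrite !dot_lin (dotC Y X); lra.
  have := potential_decrease (ltW s0) (ltW s1) i0 h3 h1 h2.
  clear h1 h2 h3; move: X Y => X Y.
  set l := (X in X <= _ -> _); set r := (X in _ <= X -> _).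
  move=> h; apply: (le_trans (y := l)).
    rewrite le_eqVlt /l; apply/orP; left; apply/eqP.
    rewrite !dot_lin (dotC Y X) (dotC Y g) (dotC X g) alphaE.
    by field; rewrite lt0r_neq0.
  apply: (le_trans h); rewrite le_eqVlt /r; apply/orP; left; apply/eqP.
  rewrite !dot_lin (dotC Y X); ring.
set VP := _ * dot _ _ + (f x - f xs) in hd.
have fx0 : mu / 2 * dot X X <= f x - f xs by exact: (gap_lb mu0 muL hf hxs).
have VPx : f x - f xs <= VP by rewrite lerDr mulr_ge0 ?dot_ge0 ?ltW.
have VP0 : 0 <= VP.
  apply: le_trans VPx; apply: le_trans fx0.
  by rewrite mulr_ge0 ?dot_ge0 ?divr_ge0 ?ltW.
have D2 : dot ((1 + beta) *: (Y - alpha *: g) - beta *: X)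
  ((1 + beta) *: (Y - alpha *: g) - beta *: X) <= 20 / mu * VP.
  (* [Y - alpha *: g] is the noiseless new iterate relative to xs. Quadratic growth bounds its
     square by the gap in f there, and [h_up] at 0 with [hd] bounds that gap by [VP]. *)
  have hY : mu / 2 * dot (Y - alpha *: g) (Y - alpha *: g) <= VP.
    have := gap_lb mu0 muL hf hxs (y - alpha *: g).
    rewrite [_ - xs](_ : _ = Y - alpha *: g); last by rewrite addrAC.
    move=> /le_trans; apply.
    have := h_up 0; rewrite addr0 -(scale0r 0) dotZl mul0r mulr0 addr0 => h.
    have h0 := mulr_ge0 (ltW s0) VP0.
    have h1 := mulr_ge0 (ltW i0) (dot_ge0 (Y - (1 - s) *: X - alpha *: g)).
    by lra.
  have hX : mu / 2 * dot X X <= VP by exact: le_trans VPx.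
  by apply: dot_comb_le => //; [rewrite addr_ge0|lra].
(* The 60 of the step size is spent here: 2 alpha eta^2 (20 / mu) <= 40 s / 60. The contraction
   factor becomes 1 - s + 2s/3 = 1 - s/3. *)
have k1 : 2 * alpha * eta ^+ 2 * dot ((1 + beta) *: (Y - alpha *: g) - beta *: X)
    ((1 + beta) *: (Y - alpha *: g) - beta *: X) <= 2 / 3 * s * VP.
  have ae0 : 0 <= 2 * alpha * eta ^+ 2.
    by apply: mulr_ge0; [apply: mulr_ge0 => //; apply: ltW|apply: sqr_ge0].
  apply: (le_trans (ler_wpM2l ae0 D2)); rewrite !mulrA ler_wpM2r//.
  rewrite -ler_pdivlMr ?invr_gt0// invrK.
  by have := alpha_eta; lra.
(* The eta term of the old potential absorbs the growth of the noise: the coefficient is at most 61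
   alpha / 60, while 2 (1 - s/3) >= 5/3. *)
have k2 : noise_coef * (eta ^+ 2 * dot Y Y) <=
    (1 - s / 3) * (2 * alpha * eta ^+ 2 * dot Y Y).
  have [_ hc] := noise_coef_bounds.
  have eY : 0 <= eta ^+ 2 * dot Y Y by rewrite mulr_ge0 ?sqr_ge0 ?dot_ge0.
  rewrite [leRHS](_ : _ = (1 - s / 3) * 2 * alpha * (eta ^+ 2 * dot Y Y)).
    rewrite ler_wpM2r//.
    have := ler_wpM2r (ltW alpha0) (s_half : s <= 2^-1).
    by have := alpha0; lra.
  by ring.
have -> : (1 - s + e * beta) *: X - (1 + e * (1 + beta)) *: Y +
    (alpha * (1 + e * (1 + beta))) *: g =
  - (Y - (1 - s) *: X - alpha *: g)
  - e *: ((1 + beta) *: (Y - alpha *: g) - beta *: X).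
  by apply/colP => i; rewrite !mxE; ring.
have -> : Y - (1 - s) *: X - alpha *: (g + n) =
   Y - (1 - s) *: X - alpha *: g - alpha *: n.
  by rewrite (scalerDr alpha g n) (opprD (alpha *: g)) addrA.
have := h_up n.
move: hd k1; set U := Y - (1 - s) *: X - alpha *: g.
set W := (1 + beta) *: (Y - alpha *: g) - beta *: X.
move: U W => U W hd k1 hn.
have -> : (2 * alpha)^-1 * dot (U - alpha *: n) (U - alpha *: n) =
   (2 * alpha)^-1 * dot U U - dot n U + alpha / 2 * dot n n.
  by rewrite !dot_lin (dotC U n); field; rewrite lt0r_neq0.
have -> : 2 * alpha * eta ^+ 2 * dot (W - (alpha * (1 + beta)) *: n)
      (W - (alpha * (1 + beta)) *: n) =
  2 * alpha * eta ^+ 2 * dot W W - e * dot n W +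
  2 * alpha ^+ 3 * eta ^+ 2 * (1 + beta) ^+ 2 * dot n n.
  by rewrite !dot_lin (dotC W n) /e; ring.
have -> : dot n (- U - e *: W) = - dot n U - e * dot n W.
  by rewrite !dot_lin.
have -> : (1 - s / 3) * ((2 * alpha)^-1 * dot ((1 + s) *: Y - X) ((1 + s) *: Y - X)
    + 2 * alpha * eta ^+ 2 * dot Y Y + (f x - f xs)) =
  (1 - s / 3) * VP + (1 - s / 3) * (2 * alpha * eta ^+ 2 * dot Y Y).
  by rewrite /VP; ring.
have cE : noise_coef * (dot n n - eta ^+ 2 * dot Y Y) =
  alpha * dot n n + 2 * alpha ^+ 3 * eta ^+ 2 * (1 + beta) ^+ 2 * dot n n
  - noise_coef * (eta ^+ 2 * dot Y Y) by rewrite /noise_coef; ring.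
rewrite cE; clear cE.
move: k2 hd k1 hn.
move: (noise_coef * _) ((1 - s / 3) * (2 * _ * _ * _)) => c1 c2.
move: (2 * alpha * eta ^+ 2 * dot W W) (e * dot n W) => c3 c4.
move: (_ * (1 + beta) ^+ 2 * dot n n) => c5.
move: ((2 * alpha)^-1 * dot U U) => c6.
lra.
Qed.

End step.

(** * Borel measurability of vector-valued maps *)

Section borelV.
Context {R : realType} {d : nat}.

Lemma continuous_measurable_borelV (F : 'cV[R]_d -> R) :
  continuous F -> measurable_fun [set: borelV R d] (F : borelV R d -> R).
Proof.
move=> cF; apply: (measurability _ (RGenOpens.measurableE R)).
move=> _ [_ [a [b ->]] <-]; rewrite setTI.
apply: sub_sigma_algebra; move/continuousP: cF; apply.
exact: interval_open.
Qed.

(** Sup-norm boxes with rational centres and radii 1/(n+1) form a countable family. The first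
    conjunct empties every box that is not contained in [U]. *)
Lemma open_rat_boxes (U : set 'cV[R]_d) : open U ->
  U = \bigcup_(qn in [set: 'cV[rat]_d * nat])
    [set v | (forall u : 'cV[R]_d,
        (forall i, `|ratr (qn.1 i ord0) - u i ord0| < qn.2.+1%:R^-1) -> U u) /\
      forall i, `|ratr (qn.1 i ord0) - v i ord0| < qn.2.+1%:R^-1].
Proof.
move=> oU; apply/seteqP; split=> [v Uv|v [qn _ [h /h]]//].
have /nbhs_ballP[e /= e0 eU] : nbhs v U by exact: open_nbhs_nbhs.
(* Twice the radius stays below [e], because points of the box are compared with [v] through the
   rational centre. *)
have [n /= ne] : exists n, n.+1%:R^-1 + n.+1%:R^-1 < e.
  have /ltr_add_invr[n] : 0 < e / 2 by rewrite divr_gt0.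
  by rewrite add0r => ne; exists n; rewrite [e]splitr ltrD.
have n0 : 0 < n.+1%:R^-1 :> R by rewrite invr_gt0.
have /choice[q hq] (i : 'I_d) : exists q : rat, `|ratr q - v i ord0| < n.+1%:R^-1.
  have : v i ord0 - n.+1%:R^-1 < v i ord0 + n.+1%:R^-1.
    by rewrite ltrBlDr -addrA ltrDl addr_gt0.
  by move=> /rat_in_itvoo[q]; rewrite in_itv/= => qv; exists q; rewrite ltr_distl.
exists (\col_i q i, n) => //=; split; last by move=> i; rewrite mxE.
move=> u hu; apply: eU; split=> // i j; rewrite ord1 /ball/=.
have := hu i; rewrite mxE distrC => hui.
have := ler_distD (ratr (q i)) (v i ord0) (u i ord0).
move=> h; apply: (le_lt_trans h); apply: lt_trans ne; apply: ltrD.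
  by rewrite distrC; exact: hq.
by rewrite distrC.
Qed.

(** The preimage of an open set is, by [open_rat_boxes], a countable union of finite intersections
    of conditions on single coordinates. *)
Lemma measurable_borelVP {dT} {T : measurableType dT} (h : T -> borelV R d) :
  measurable_fun [set: T] h <->
  forall i, measurable_fun [set: T] (fun t => (h t : 'cV[R]_d) i ord0).
Proof.
split=> [mh i|mh].
  apply: (measurableT_comp (f := fun v : borelV R d => (v : 'cV[R]_d) i ord0)) => //.
  by apply: continuous_measurable_borelV; exact: coord_continuous.
apply: (@measurability _ _ T (borelV R d) _ h (@open 'cV[R]_d) (erefl _)).
move=> _ [U oU <-]; rewrite setTI (open_rat_boxes _ oU) preimage_bigcup.
apply: countable_bigcupT_measurable; first exact: countableP.
move=> [q n] /=.
set B := (X in measurable (h @^-1` X)).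
have [hB|hB] := pselect (forall u : 'cV[R]_d,
    (forall i, `|ratr (q i ord0) - u i ord0| < n.+1%:R^-1) -> U u); last first.
  by rewrite [_ @^-1` _](_ : _ = set0)//; apply/seteqP; split=> // t [].
rewrite [_ @^-1` _](_ : _ = \bigcap_(i in [set: 'I_d])
   [set t | `|ratr (q i ord0) - (h t : 'cV[R]_d) i ord0| < n.+1%:R^-1]).
  apply: fin_bigcap_measurable; first exact: finite_finset.
  move=> i _.
  have mi : measurable_fun setT
      (fun t => `|ratr (q i ord0) - (h t : 'cV[R]_d) i ord0|).
    by apply: measurableT_comp => //; apply: measurable_funB.
  have := mi measurableT _ (measurable_itv `]-oo, n.+1%:R^-1[%R).
  by rewrite setTI; congr measurable.
apply/predeqP => t; split=> [[_ H] i _|H]; first exact: H.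
by split=> // i; exact: H.
Qed.

End borelV.

(** * Joint law of an independent pair and Fubini *)

Section independent_pair.
Local Open Scope ereal_scope.
Context {R : realType} {dT dS dW : measure_display} {T : measurableType dT}.
Context {S : measurableType dS} {W : measurableType dW} {P : probability T R}.
Variables (A : {RV P >-> S}) (B : {RV P >-> W}).
Hypothesis AB : independent P (g_sigma_algebra_preimage B)
                              (g_sigma_algebra_preimage A).

Let measurable_pair_RV : measurable_fun [set: T] (fun t => (A t, B t)).
Proof. exact: measurable_fun_pair. Qed.

Let pair_mixin := isMeasurableFun.Build _ _ _ _ _ measurable_pair_RV.
Let AB_RV : {mfun T >-> (S * W)%type} := HB.pack (fun t => (A t, B t)) pair_mixin.

(** Independence makes the two measures agree on measurable rectangles, which determine the product
    measure. *)
Lemma distribution_pair (X : set (S * W)) : measurable X ->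
  (distribution P A \x distribution P B) X = distribution P AB_RV X.
Proof.
apply: product_measure_unique => // U V mU mV.
rewrite /distribution /pushforward [RHS]muleC.
rewrite -AB; last 2 first.
- by exists V => //; rewrite setTI.
- by exists U => //; rewrite setTI.
by rewrite setIC.
Qed.

Variable F : S * W -> \bar R.
Hypotheses (mF : measurable_fun [set: S * W] F)
  (iF : P.-integrable [set: T] (fun t => F (A t, B t))).

Lemma integrable_pair :
  (distribution P A \x distribution P B).-integrable [set: S * W] F.
Proof.
have := integrable_pushforward measurable_pair_RV mF iF measurableT.
move=> /integrableP[_ h]; apply/integrableP; split=> //.
rewrite (eq_measure_integral (distribution P AB_RV))// => X mX _.
exact: distribution_pair.
Qed.

Lemma integrable_fubini_RV :
  P.-integrable [set: T] (fun t => fubini_F (distribution P B) F (A t)).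
Proof.
have mH := measurable_fubini_F integrable_pair.
apply/integrableP; split; first exact: measurableT_comp.
have /integrableP[_] := integrable_fubini_F integrable_pair.
by rewrite (ge0_integral_distribution A)//; exact: measurableT_comp.
Qed.

(** Change of variables to the product law, Fubini, then change of variables back along [A]. *)
Lemma integral_pair :
  \int[P]_t F (A t, B t) = \int[P]_t fubini_F (distribution P B) F (A t).
Proof.
transitivity (\int[distribution P AB_RV]_x F x).
  by rewrite (integral_distribution (X := AB_RV) mF iF).
transitivity (\int[(distribution P A \x distribution P B)]_x F x).
  by apply: eq_measure_integral => X mX _; exact/esym/distribution_pair.
rewrite -(integral12_prod_meas1 integrable_pair).
exact: (integral_distribution (X := A) (measurable_fubini_F integrable_pair)
  integrable_fubini_RV).
Qed.

End independent_pair.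

Lemma ae_distribution {R : realType} {dT dS : measure_display}
  {T : measurableType dT} {S : measurableType dS} (P : probability T R)
  (X : {RV P >-> S}) (p : S -> Prop) :
  {ae distribution P X, forall s, p s} -> {ae P, forall t, p (X t)}.
Proof.
move=> [N [mN N0 sub]]; exists (X @^-1` N); split => //.
  by rewrite -[X in measurable X]setTI; exact: measurable_funPT.
by move=> t /= h; exact: sub.
Qed.

(** * Orthogonality of the noise to functions of the state *)

Section orthogonality.
Local Open Scope ereal_scope.
Context {R : realType} {dT dS dY dW : measure_display} {T : measurableType dT}.
Context {S : measurableType dS} {Y : measurableType dY} {W : measurableType dW}.
Context {P : probability T R}.
Variables (A : {RV P >-> S}) (y : {RV P >-> Y}) (w : {RV P >-> W}).
Variables (p : S -> Y) (F : Y * W -> R) (U : S -> R).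
Hypothesis mp : measurable_fun [set: S] p.
Hypothesis pA : forall t, y t = p (A t).
Hypothesis indA : independent P (g_sigma_algebra_preimage w)
                              (g_sigma_algebra_preimage A).
Hypotheses (mF : measurable_fun [set: Y * W] F) (mU : measurable_fun [set: S] U).
Hypothesis iF : P.-integrable [set: T] (fun t => (F (y t, w t))%:E).
Hypothesis iUF : P.-integrable [set: T] (fun t => (U (A t) * F (y t, w t))%:E).
Hypothesis F0 : forall B, g_sigma_algebra_preimage y B ->
  \int[P]_(t in B) (F (y t, w t))%:E = 0.

Let indy : independent P (g_sigma_algebra_preimage w) (g_sigma_algebra_preimage y).
Proof.
move=> B C hB [D mD <-]; apply: indA => //.
exists (p @^-1` D); first by rewrite -[X in measurable X]setTI; exact: mp.
by rewrite !setTI; apply/seteqP; split=> t /=; rewrite pA.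
Qed.

(** H(v) is the mean of F(v, w) with v frozen; for a coordinate of the noise it is that coordinate
    of h(v). *)
Let H := fubini_F (distribution P w) (EFin \o F).

Let mEF : measurable_fun [set: Y * W] (EFin \o F).
Proof. exact/measurable_EFinP. Qed.

(** For measurable E, the integral of H over E under the law of y equals E[1_E(y) F(y, w)], which
    [F0] makes zero. *)
Let H_ae0 : {ae distribution P y, forall v, H v = 0}.
Proof.
have iH := integrable_fubini_F (integrable_pair y w indy _ mEF iF).
have : ae_eq (distribution P y) setT H (cst 0).
  apply: integral_ae_eq => // E _ mE.
  rewrite integral_cst// mul0e.
  have mIF : measurable_fun setT (fun z : Y * W => (\1_E z.1 * F z)%:E).
    apply/measurable_EFinP/measurable_funM => //.
    by apply: measurableT_comp.
  have mB : measurable (y @^-1` E).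
    by rewrite -[X in measurable X]setTI; exact: measurable_funPT.
  have EB t : (\1_E (y t) * F (y t, w t))%:E =
      ((fun t => (F (y t, w t))%:E) \_ (y @^-1` E)) t.
    rewrite patchE indicE; have [yE|yE] := pselect (E (y t)).
      by rewrite !mem_set// mul1r.
    by rewrite !memNset// mul0r.
  have iIF : P.-integrable setT (fun t => (\1_E (y t) * F (y t, w t))%:E).
    under eq_fun do rewrite EB.
    by apply/(integrable_mkcond _ mB); exact: integrableS iF.
  have HE v : fubini_F (distribution P w) (fun z => (\1_E z.1 * F z)%:E) v =
      (H \_ E) v.
    rewrite patchE /fubini_F /=; have [vE|vE] := pselect (E v).
      by rewrite mem_set//; under eq_integral do rewrite indicE mem_set// mul1r.
    rewrite memNset//; under eq_integral do rewrite indicE memNset// mul0r.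
    by rewrite integral0.
  have iHE := integrable_fubini_RV y w indy _ mIF iIF.
  rewrite integral_mkcond -(funext HE).
  rewrite (integral_distribution (X := y) _ iHE); last first.
    exact: measurable_fubini_F (integrable_pair y w indy _ mIF iIF).
  rewrite -[LHS](integral_pair y w indy _ mIF iIF).
  under eq_integral do rewrite EB.
  by rewrite -integral_mkcond F0//; exists E => //; rewrite setTI.
move=> [N [mN N0 sub]]; exists N; split => // t /= h; apply: sub => /= h2.
by apply: h; exact: h2.
Qed.

(** Integrating out w first leaves U(A) H(y), since y = p(A), and H(y) vanishes almost surely
    whatever the dependence of U on A. *)
Lemma integral_orthogonal : \int[P]_t (U (A t) * F (y t, w t))%:E = 0.
Proof.
have mG : measurable_fun setT (fun z : S * W => (U z.1 * F (p z.1, z.2))%:E).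
  apply/measurable_EFinP/measurable_funM; first exact: measurableT_comp.
  apply: (measurableT_comp mF); apply: measurable_fun_pair => //.
  exact: measurableT_comp.
have GE t : (U (A t) * F (y t, w t))%:E =
   (fun z : S * W => (U z.1 * F (p z.1, z.2))%:E) (A t, w t) by rewrite /= pA.
have iG : P.-integrable [set: T]
    (fun t => (fun z : S * W => (U z.1 * F (p z.1, z.2))%:E) (A t, w t)).
  by under eq_fun do rewrite -GE.
under eq_integral do rewrite GE.
rewrite (integral_pair A w indA _ mG iG) -[RHS](integral0 P setT).
apply: ae_eq_integral => //.
  exact: measurable_int (integrable_fubini_RV A w indA _ mG iG).
have h1 := ae_distribution _ _ _ H_ae0.
(* Almost every section F(y(t), .) is integrable, which allows the factor U(A(t)) to leave the inner
   integral. *)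
have h2 := ae_distribution _ _ _ (ae_integrable1 (integrable_pair y w indy _ mEF iF)).
apply: filterS2 h1 h2 => t h0 hi _; rewrite /fubini_F /= -pA.
under eq_integral do rewrite EFinM.
by rewrite integralZl// -[X in _ * X]/(H (y t)) h0 mule0.
Qed.

End orthogonality.

(** * Measurability of the iterates and of the gradient *)

Section measurability.
Context {R : realType} {d : nat} {dT : measure_display} {T : measurableType dT}.

Lemma measurable_dot (u v : T -> 'cV[R]_d) :
  measurable_fun [set: T] (u : T -> borelV R d) ->
  measurable_fun [set: T] (v : T -> borelV R d) ->
  measurable_fun [set: T] (fun t => dot (u t) (v t)).
Proof.
move=> /measurable_borelVP mu /measurable_borelVP mv.
apply: measurable_sum => i; exact: measurable_funM.
Qed.

Lemma measurable_addV (u v : T -> 'cV[R]_d) :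
  measurable_fun [set: T] (u : T -> borelV R d) ->
  measurable_fun [set: T] (v : T -> borelV R d) ->
  measurable_fun [set: T] (fun t => u t + v t : borelV R d).
Proof.
move=> /measurable_borelVP mu /measurable_borelVP mv; apply/measurable_borelVP => i.
under eq_fun do rewrite mxE; exact: measurable_funD.
Qed.

Lemma measurable_scaleV (a : R) (u : T -> 'cV[R]_d) :
  measurable_fun [set: T] (u : T -> borelV R d) ->
  measurable_fun [set: T] (fun t => a *: u t : borelV R d).
Proof.
move=> /measurable_borelVP mu; apply/measurable_borelVP => i.
under eq_fun do rewrite mxE; exact: measurable_funM.
Qed.

Lemma measurable_subV (u v : T -> 'cV[R]_d) :
  measurable_fun [set: T] (u : T -> borelV R d) ->
  measurable_fun [set: T] (v : T -> borelV R d) ->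
  measurable_fun [set: T] (fun t => u t - v t : borelV R d).
Proof.
move=> mu mv; under eq_fun do rewrite -scaleN1r.
by apply: measurable_addV => //; exact: measurable_scaleV.
Qed.

Lemma measurable_extrapolate (b : R) (xi : T -> 'cV[R]_(d + d)) :
  measurable_fun [set: T] (fun t => usubmx (xi t) : borelV R d) ->
  measurable_fun [set: T] (fun t => dsubmx (xi t) : borelV R d) ->
  measurable_fun [set: T] (fun t => extrapolate b (xi t) : borelV R d).
Proof. by move=> mu md; apply: measurable_subV; exact: measurable_scaleV. Qed.

(** The sigma-algebra on [T] is left arbitrary and only the [w j] with j < k are constrained: the
    lemma serves for the ambient sigma-algebra and again for the one generated by the past. *)
Lemma measurable_asg_state {dW : measure_display} {W : measurableType dW}
    (alpha beta : R) (g : borelV R d * W -> borelV R d)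
    (x0 xm1 : T -> borelV R d) (w : nat -> T -> W) (k : nat) :
  measurable_fun setT g -> measurable_fun setT x0 -> measurable_fun setT xm1 ->
  (forall j, (j < k)%N -> measurable_fun setT (w j)) ->
  let xi t := asg_state alpha beta g (x0 t) (xm1 t) (fun j => w j t) k in
  measurable_fun [set: T] (fun t => usubmx (xi t) : borelV R d) /\
  measurable_fun [set: T] (fun t => dsubmx (xi t) : borelV R d).
Proof.
move=> mg mx0 mxm1; elim: k => [_|k IH mw] /=.
  by split; [under eq_fun do rewrite col_mxKu|under eq_fun do rewrite col_mxKd].
have [j jk|mu md] := IH; first by apply: mw; exact: ltnW.
have my := measurable_extrapolate beta _ mu md.
split; last by under eq_fun do rewrite col_mxKd.
under eq_fun do rewrite col_mxKu.
apply: measurable_subV => //; apply: measurable_scaleV.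
by apply: (measurableT_comp mg); apply: measurable_fun_pair => //; exact: mw.
Qed.

End measurability.

Section smooth_measurable.
Context {R : realType} {d : nat} {mu L : R} {f : 'cV[R]_d -> R}.
Hypothesis hf : smooth_strongly_convex mu L f.

Lemma measurable_smooth : measurable_fun setT (f : borelV R d -> R).
Proof.
apply: continuous_measurable_borelV => x.
by have [[df _] _] := hf; exact: differentiable_continuous.
Qed.

Lemma measurable_grad : measurable_fun setT (grad f : borelV R d -> borelV R d).
Proof.
apply/measurable_borelVP => i; apply: continuous_measurable_borelV => x.
have [[_ cg] _] := hf.
apply: (continuous_comp (g := fun v : 'cV[R]_d => v i ord0)); first exact: cg.
exact: coord_continuous.
Qed.

End smooth_measurable.

(** * Quadratic quantities dominated by the potential *)

Section second_moments.
Context {R : realType} {d : nat} {mu L : R} {f : 'cV[R]_d -> R} {xs : 'cV[R]_d}.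
Context {eta alpha s beta : R}.
Hypotheses (mu0 : 0 < mu) (muL : mu <= L).
Hypotheses (hf : smooth_strongly_convex mu L f) (hxs : unique_minimizer f xs).
Hypotheses (alpha0 : 0 < alpha) (s0 : 0 < s).
Hypothesis (betaE : beta = (1 - s) / (1 + s)).

Let V := @potential R d f xs eta alpha s beta.

Let sqs_ge0 xi :
  [/\ 0 <= (2 * alpha)^-1 * dot (usubmx xi - xs - (1 - s) *: (dsubmx xi - xs))
                (usubmx xi - xs - (1 - s) *: (dsubmx xi - xs)),
      0 <= 2 * alpha * eta ^+ 2 *
        dot (extrapolate beta xi - xs) (extrapolate beta xi - xs),
      0 <= f (usubmx xi) - f xs &
      mu / 2 * dot (usubmx xi - xs) (usubmx xi - xs) <= f (usubmx xi) - f xs].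
Proof.
split; last exact: (gap_lb mu0 muL hf hxs).
- apply: mulr_ge0 (dot_ge0 _); rewrite invr_ge0.
  by apply: mulr_ge0 => //; exact: ltW.
- apply: mulr_ge0 (dot_ge0 _); apply: mulr_ge0 (sqr_ge0 _).
  by apply: mulr_ge0 => //; exact: ltW.
- by rewrite subr_ge0 (min_le hxs).
Qed.

Lemma potential_ge0 xi : 0 <= V xi.
Proof. by have [h1 h2 h3 _] := sqs_ge0 xi; apply: addr_ge0 => //; apply: addr_ge0. Qed.

Lemma sq_x_le xi :
  dot (usubmx xi - xs) (usubmx xi - xs) <= 2 / mu * V xi.
Proof.
have [h1 h2 h3 h4] := sqs_ge0 xi.
rewrite mulrAC ler_pdivlMr// /V /potential.
by lra.
Qed.

(** (1 + s) Y = u + X, where |u|^2 <= 2 alpha V by the first square and |X|^2 <= 2 V / mu by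
    quadratic growth. *)
Lemma sq_y_le xi :
  dot (extrapolate beta xi - xs) (extrapolate beta xi - xs) <=
  (4 * alpha + 4 / mu) * V xi.
Proof.
have [h1 h2 h3 _] := sqs_ge0 xi; have hx := sq_x_le xi.
set X := usubmx xi - xs in h1 hx *; set Z := dsubmx xi - xs in h1.
set Y := extrapolate beta xi - xs.
set u := X - (1 - s) *: Z in h1.
have hu : dot u u <= 2 * alpha * V xi.
  rewrite -ler_pdivrMl ?mulr_gt0// /V /potential -/X -/Z -/u.
  by lra.
have uX : (1 + s) *: Y = u + X.
  have s1n : 1 + s != 0 by rewrite lt0r_neq0// addr_gt0.
  rewrite /u /Y /X /Z /extrapolate betaE; apply/colP => i; rewrite !mxE.
  by field.
have hY : dot Y Y <= dot (u + X) (u + X).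
  rewrite -uX dotZl dotZr mulrA ler_peMl ?dot_ge0//.
  by have := s0; move: s => s' s'0; nra.
have h : dot (u + X) (u + X) <= 2 * dot u u + 2 * dot X X.
  exact: dot_add_le.
rewrite mulrDl; apply: (le_trans hY); apply: (le_trans h).
by move: (V xi) hu hx => v; lra.
Qed.

Lemma sq_grad_le y : dot (grad f y) (grad f y) <= L ^+ 2 * dot (y - xs) (y - xs).
Proof.
have h1 := grad_sq_le mu0 muL hf hxs y; have h2 := gap_ub mu0 muL hf hxs y.
apply: (le_trans h1).
have L0 : 0 <= 2 * L by rewrite mulr_ge0// (le_trans (ltW mu0)).
apply: (le_trans (ler_wpM2l L0 h2)).
by rewrite le_eqVlt; apply/orP; left; apply/eqP; field.
Qed.

(** This makes M square integrable as soon as the potential is integrable. *)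
Lemma sq_cross_le : exists K, forall xi,
  dot (@cross_term R d f xs eta alpha s beta xi)
      (@cross_term R d f xs eta alpha s beta xi) <= K * V xi.
Proof.
set e := 4 * alpha ^+ 2 * eta ^+ 2 * (1 + beta).
set p := 1 - s + e * beta; set q := 1 + e * (1 + beta).
exists (3 * (p ^+ 2 * (2 / mu)) +
  3 * (q ^+ 2 + (alpha * q) ^+ 2 * L ^+ 2) * (4 * alpha + 4 / mu)) => xi.
rewrite /cross_term -/e -/p -/q.
have hx := ler_wpM2l (sqr_ge0 p) (sq_x_le xi).
have hy := sq_y_le xi.
have hg := ler_wpM2l (sqr_ge0 (alpha * q)) (sq_grad_le (extrapolate beta xi)).
set X := usubmx xi - xs in hx *; set Y := extrapolate beta xi - xs in hy hg *.
set g := grad f _ in hg *.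
have h : dot (p *: X - q *: Y + (alpha * q) *: g)
             (p *: X - q *: Y + (alpha * q) *: g) <=
    3 * (p ^+ 2 * dot X X) + 3 * (q ^+ 2 * dot Y Y) +
    3 * ((alpha * q) ^+ 2 * dot g g).
  exact: dot_comb3_le.
apply: (le_trans h).
have c0 : 0 <= 3 * (q ^+ 2 + (alpha * q) ^+ 2 * L ^+ 2).
  apply: mulr_ge0 => //; apply: addr_ge0; first exact: sqr_ge0.
  by apply: mulr_ge0; exact: sqr_ge0.
have hy' := ler_wpM2l c0 hy.
move: hx hg hy'; move: (V xi) (dot X X) (dot Y Y) (dot g g) => v a b c.
lra.
Qed.

End second_moments.

(** * One step in expectation *)

Section one_step.
Local Open Scope ereal_scope.
Context {R : realType} {d : nat} {mu L : R} {f : 'cV[R]_d -> R} {xs : 'cV[R]_d}.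
Context {sigma eta alpha s beta : R}.
Hypotheses (mu0 : (0 < mu)%R) (muL : (mu <= L)%R).
Hypotheses (hf : smooth_strongly_convex mu L f) (hxs : unique_minimizer f xs).
Hypotheses (alpha0 : (0 < alpha)%R) (s0 : (0 < s)%R) (s_half : (s <= 2^-1)%R).
Hypothesis (s2 : (s ^+ 2 = alpha * mu)%R).
Hypothesis (alphaL : (alpha * L <= 1)%R).
Hypothesis (alpha_eta : (alpha * eta ^+ 2 <= s * mu / 60)%R).
Hypothesis (betaE : (beta = (1 - s) / (1 + s))%R).
Context {dT dW : measure_display} {T : measurableType dT} {W : measurableType dW}.
Context {P : probability T R} {g : borelV R d * W -> borelV R d}.
Hypothesis mg : measurable_fun setT g.
Variables (xi : T -> 'cV[R]_(d + d)) (w : {RV P >-> W}).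
Hypothesis mx : measurable_fun [set: T] (fun t => usubmx (xi t) : borelV R d).
Hypothesis mz : measurable_fun [set: T] (fun t => dsubmx (xi t) : borelV R d).
Let pair_of t : borelV R d * borelV R d := (usubmx (xi t), dsubmx (xi t)).
Hypothesis ind : independent P (g_sigma_algebra_preimage w)
                               (g_sigma_algebra_preimage pair_of).
Let y t := extrapolate beta (xi t).
Hypothesis noise : noise_model P f xs sigma eta y (fun t => g (y t, w t)).

Let V := @potential R d f xs eta alpha s beta.
Let n t : 'cV[R]_d := (g (y t, w t) - grad f (y t))%R.
Let C t := @cross_term R d f xs eta alpha s beta (xi t).

Let my : measurable_fun [set: T] (y : T -> borelV R d).
Proof. exact: measurable_extrapolate. Qed.

Let mn : measurable_fun [set: T] (n : T -> borelV R d).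
Proof.
apply: measurable_subV; last exact: measurableT_comp (measurable_grad hf) my.
by apply: (measurableT_comp mg); exact: measurable_fun_pair.
Qed.

Lemma measurable_potential (z : T -> 'cV[R]_(d + d)) :
  measurable_fun [set: T] (fun t => usubmx (z t) : borelV R d) ->
  measurable_fun [set: T] (fun t => dsubmx (z t) : borelV R d) ->
  measurable_fun [set: T] (fun t => V (z t)).
Proof.
move=> mu_ md.
have mc : measurable_fun [set: T] (fun=> xs : borelV R d) by [].
have mX := measurable_subV _ _ mu_ mc.
have mZ := measurable_subV _ _ md mc.
have mY := measurable_subV _ _ (measurable_extrapolate beta _ mu_ md) mc.
have mU := measurable_subV _ _ mX (measurable_scaleV (1 - s) _ mZ).
apply: measurable_funD.
  apply: measurable_funD; apply: measurable_funM => //; exact: measurable_dot.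
apply: measurable_funB => //.
exact: measurableT_comp (measurable_smooth hf) mu_.
Qed.

Section one_step_integrable.
Hypothesis iV : P.-integrable [set: T] (fun t => (V (xi t))%:E).

Let mC : measurable_fun [set: T] (C : T -> borelV R d).
Proof.
have mc : measurable_fun [set: T] (fun=> xs : borelV R d) by [].
apply: measurable_addV.
  apply: measurable_subV; apply: measurable_scaleV; exact: measurable_subV.
apply: measurable_scaleV.
exact: measurableT_comp (measurable_grad hf) my.
Qed.

Lemma integrable_dominated (h : T -> R) (K : R) (v : T -> R) :
  measurable_fun [set: T] h -> P.-integrable [set: T] (EFin \o v) ->
  (forall t, 0 <= h t)%R -> (forall t, h t <= K * v t)%R ->
  P.-integrable [set: T] (EFin \o h).
Proof.
move=> mh iv h0 hv; apply: (le_integrable measurableT _ _ (integrableZl measurableT K iv)).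
  exact/measurable_EFinP.
by move=> t _ /=; rewrite lee_fin ger0_norm// (le_trans (hv t))// ler_norm.
Qed.

Let iYY : P.-integrable [set: T] (fun t => (dot (y t - xs) (y t - xs))%:E).
Proof.
apply: (integrable_dominated _ (4 * alpha + 4 / mu) (V \o xi)) => //.
- by apply: measurable_dot; exact: measurable_subV.
- by move=> t; exact: dot_ge0.
- move=> t; exact: (sq_y_le mu0 muL hf hxs alpha0 s0 betaE).
Qed.

Let iCC : P.-integrable [set: T] (fun t => (dot (C t) (C t))%:E).
Proof.
have [K hK] := @sq_cross_le R d mu L f xs eta alpha s beta mu0 muL hf hxs alpha0 s0 betaE.
apply: (integrable_dominated _ K (V \o xi)) => //.
- exact: measurable_dot.
- by move=> t; exact: dot_ge0.
- by move=> t; exact: hK.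
Qed.

Let bound t := (sigma ^+ 2 + eta ^+ 2 * dot (y t - xs) (y t - xs))%R.

Let iB : P.-integrable [set: T] (EFin \o bound).
Proof.
rewrite (_ : EFin \o bound = (EFin \o cst (sigma ^+ 2)%R) \+
    (fun t => (eta ^+ 2)%:E * (dot (y t - xs) (y t - xs))%:E)).
  apply: integrableD => //; first exact: finite_measure_integrable_cst.
  exact: integrableZl.
by apply/funext => t.
Qed.

Lemma noise_sq_le :
  \int[P]_t (dot (n t) (n t))%:E <= \int[P]_t (bound t)%:E.
Proof.
have [_ [Z [[_ mZ hZ] Zb]]] := noise.
(* The conditional second moment is tested on the whole space, which turns it into an unconditional
   one. *)
have gT : g_sigma_algebra_preimage (T' := borelV R d) y setT.
  by exists setT => //; rewrite setTI preimage_setT.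
have := hZ _ gT; under [in X in _ = X -> _]eq_integral do rewrite sqnormE.
move=> <-.
have mZT : measurable_fun [set: T] Z.
  move=> _ B mB; have [D mD <-] := mZ measurableT B mB.
  exact: my measurableT D mD.
have b0 t : (0 <= bound t)%R.
  by rewrite addr_ge0 ?sqr_ge0// mulr_ge0 ?sqr_ge0 ?dot_ge0.
(* The bound on [Z] holds only almost surely and [Z] may be negative; its positive part allows the
   monotonicity of integrals of nonnegative functions. *)
apply: (@le_trans _ _ (\int[P]_t (Z^\+ t))).
  rewrite integralE geeDl// oppe_le0; exact: integral_ge0.
apply: ae_ge0_le_integral => //.
- exact: measurable_funepos.
- by move=> t _; rewrite lee_fin.
- exact: measurable_int iB.
apply: filterS Zb => t Zt _.
by rewrite funeposE ge_max lee_fin b0 andbT /bound -sqnormE.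
Qed.

Let inn : P.-integrable [set: T] (fun t => (dot (n t) (n t))%:E).
Proof.
apply/integrableP; split; first exact/measurable_EFinP/measurable_dot.
under eq_integral do rewrite gee0_abs ?lee_fin ?dot_ge0//.
apply: le_lt_trans noise_sq_le _; exact: integrable_lty.
Qed.

Let iconst (c : R) : P.-integrable [set: T] (EFin \o cst c).
Proof. exact: finite_measure_integrable_cst. Qed.

Lemma integrable_coord (u : T -> 'cV[R]_d) (i : 'I_d) :
  measurable_fun [set: T] (u : T -> borelV R d) ->
  P.-integrable [set: T] (fun t => (dot (u t) (u t))%:E) ->
  P.-integrable [set: T] (fun t => (u t i ord0)%:E).
Proof.
move=> /measurable_borelVP mu_ iu.
apply: (le_integrable measurableT _ _ (integrableD measurableT (iconst 1) iu)).
  exact/measurable_EFinP.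
move=> t _ /=; rewrite lee_fin.
have := coord_sq_le (u t) i; set q := u t i ord0 => h.
(* |q| <= 1 + q^2, and constants are integrable under a probability. *)
apply: le_trans (ler_norm _); rewrite ler_norml; apply/andP; split; nra.
Qed.

Lemma integrable_coordM (u v : T -> 'cV[R]_d) (i : 'I_d) :
  measurable_fun [set: T] (u : T -> borelV R d) ->
  measurable_fun [set: T] (v : T -> borelV R d) ->
  P.-integrable [set: T] (fun t => (dot (u t) (u t))%:E) ->
  P.-integrable [set: T] (fun t => (dot (v t) (v t))%:E) ->
  P.-integrable [set: T] (fun t => (u t i ord0 * v t i ord0)%:E).
Proof.
move=> /measurable_borelVP mu_ /measurable_borelVP mv iu iv.
apply: (le_integrable measurableT _ _ (integrableD measurableT iu iv)).
  exact/measurable_EFinP/measurable_funM.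
move=> t _ /=; rewrite lee_fin.
have := coord_sq_le (u t) i; have := coord_sq_le (v t) i.
set p := u t i ord0; set q := v t i ord0 => hq hp.
apply: le_trans (ler_norm _); rewrite ler_norml; apply/andP; split; nra.
Qed.

(** An instance of [integral_orthogonal]: A is the pair (x_k, x_{k-1}), U a coordinate of M and F
    the same coordinate of the noise. *)
Lemma cross0 i : \int[P]_t (C t i ord0 * n t i ord0)%:E = 0.
Proof.
have mgy : measurable_fun [set: T] (fun t => grad f (y t) : borelV R d).
  exact: measurableT_comp (measurable_grad hf) my.
have ig : P.-integrable [set: T] (fun t => (grad f (y t) i ord0)%:E).
  apply: integrable_coord => //.
  apply: (integrable_dominated _ (L ^+ 2) (fun t => dot (y t - xs) (y t - xs))) => //.
  - exact: measurable_dot.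
  - by move=> t; exact: dot_ge0.
  - by move=> t; exact: (sq_grad_le mu0 muL hf hxs).
have iG : P.-integrable [set: T] (fun t => ((g (y t, w t) : 'cV[R]_d) i ord0)%:E).
  apply: eq_integrable (integrableD measurableT (integrable_coord n i mn inn) ig) => //.
  by move=> t _; rewrite /n /= !mxE -EFinD subrK.
pose st (xz : borelV R d * borelV R d) : 'cV[R]_(d + d) := col_mx xz.1 xz.2.
have mst1 : measurable_fun setT (fun xz => usubmx (st xz) : borelV R d).
  under eq_fun do rewrite col_mxKu; exact: measurable_fst.
have mst2 : measurable_fun setT (fun xz => dsubmx (st xz) : borelV R d).
  under eq_fun do rewrite col_mxKd; exact: measurable_snd.
have mp : measurable_fun setT (fun xz => extrapolate beta (st xz) : borelV R d).
  exact: measurable_extrapolate.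
have mcr : measurable_fun setT
    (fun xz => @cross_term R d f xs eta alpha s beta (st xz) : borelV R d).
  apply: measurable_addV.
    apply: measurable_subV; apply: measurable_scaleV; exact: measurable_subV.
  apply: measurable_scaleV.
  exact: measurableT_comp (measurable_grad hf) mp.
have mpair : measurable_fun [set: T] pair_of by exact: measurable_fun_pair.
pose A_mixin := isMeasurableFun.Build _ _ _ _ _ mpair.
pose A_RV : {RV P >-> (borelV R d * borelV R d)%type} := HB.pack pair_of A_mixin.
pose y_mixin := isMeasurableFun.Build _ _ _ _ _ my.
pose y_RV : {RV P >-> borelV R d} := HB.pack (y : T -> borelV R d) y_mixin.
pose F (z : borelV R d * W) : R := ((g z : 'cV[R]_d) i ord0 - grad f z.1 i ord0)%R.
pose U xz := @cross_term R d f xs eta alpha s beta (st xz) i ord0.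
have stE t : st (pair_of t) = xi t by rewrite /st vsubmxK.
have FE t : F (y t, w t) = n t i ord0 by rewrite /F /n !mxE.
have UE t : U (pair_of t) = C t i ord0 by rewrite /U stE.
have := @integral_orthogonal R _ _ _ _ T _ _ W P A_RV y_RV w
  (fun xz => extrapolate beta (st xz)) F U mp _ ind _ _ _ _ _.
under eq_integral do rewrite /= UE FE.
apply.
- by move=> t /=; rewrite stE.
- apply: measurable_funB; first by move/measurable_borelVP : mg; exact.
  apply: (measurableT_comp (f := fun v : borelV R d => grad f v i ord0)) => //.
  by move/measurable_borelVP : (measurable_grad hf); exact.
- by move/measurable_borelVP : mcr; exact.
- by under eq_fun do rewrite /= FE; exact: integrable_coord.
- by under eq_fun do rewrite /= UE FE; exact: integrable_coordM.
(* On an event of sigma(y_k), the stochastic gradient and the true gradient have the same finite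
   integral, coordinate by coordinate. *)
- move=> B hB; have mB : measurable B.
    by have [D mD <-] := hB; exact: my measurableT D mD.
  under eq_integral do rewrite /= /F EFinB.
  have [/(_ i)[_ _ hc] _] := noise.
  have igB := integrableS measurableT mB (@subsetT _ _) ig.
  have iGB := integrableS measurableT mB (@subsetT _ _) iG.
  rewrite integralB_EFin//= -(hc _ hB) subee//.
  exact: integrable_fin_num.
Qed.

Lemma expected_step_integrable :
  \int[P]_t (V (col_mx (y t - alpha *: g (y t, w t)) (usubmx (xi t))))%:E <=
  (1 - s / 3)%:E * \int[P]_t (V (xi t))%:E + (2 * sigma ^+ 2 * alpha)%:E.
Proof.
set c := @noise_coef R eta alpha beta.
have [c0 c61] : (alpha <= c)%R /\ (60 * c <= 61 * alpha)%R.
  by apply: (noise_coef_bounds alpha0 s0 s_half s2 alpha_eta betaE).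
have c_ge0 : (0 <= c)%R by rewrite (le_trans (ltW alpha0)).
(* The pathwise bound of [potential_step], split into separately integrable pieces with <n, M>
   expanded over coordinates. *)
pose r t := (1 - s / 3)%:E * (V (xi t))%:E +
  \sum_(i < d) (C t i ord0 * n t i ord0)%:E +
  (c%:E * (dot (n t) (n t))%:E + (- (c * eta ^+ 2))%:E * (dot (y t - xs) (y t - xs))%:E).
have iX1 := integrableZl measurableT (1 - s / 3) iV.
have iX2 : P.-integrable [set: T] (fun t => \sum_(i < d) (C t i ord0 * n t i ord0)%:E).
  by apply: integrable_sum => // i _; exact: integrable_coordM.
have iX3 := integrableZl measurableT c inn.
have iX4 := integrableZl measurableT (- (c * eta ^+ 2)) iYY.
have iX12 := integrableD measurableT iX1 iX2.
have iX34 := integrableD measurableT iX3 iX4.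
have ir : P.-integrable [set: T] r := integrableD measurableT iX12 iX34.
apply: (@le_trans _ _ (\int[P]_t r t)).
  apply: ge0_le_integral => //.
  - by move=> t _; rewrite lee_fin (potential_ge0 mu0 muL hf hxs alpha0).
  - apply/measurable_EFinP; apply: measurable_potential.
      under eq_fun do rewrite col_mxKu.
      apply: measurable_subV => //; apply: measurable_scaleV.
      by apply: (measurableT_comp mg); exact: measurable_fun_pair.
    by under eq_fun do rewrite col_mxKd.
  - exact: measurable_int ir.
  move=> t _.
  have := @potential_step R d mu L f xs eta alpha s beta mu0 muL hf hxs alpha0
    s0 s_half s2 alphaL alpha_eta betaE (xi t) (g (y t, w t)) _ _ _ erefl erefl erefl.
  rewrite /r sumEFin -!EFinM -!EFinD lee_fin => /le_trans; apply.
  rewrite -/(y t) -/(n t) -/(C t) -/V -/c dotC /dot.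
  by rewrite le_eqVlt; apply/orP; left; apply/eqP; ring.
rewrite (integralD measurableT iX12 iX34) (integralD measurableT iX1 iX2).
rewrite (integralD measurableT iX3 iX4).
rewrite !integralZl// integral_sum//; last by move=> i; exact: integrable_coordM.
rewrite big1 ?adde0; last by move=> i _; exact: cross0.
apply: leeD2l.
have := noise_sq_le.
rewrite (_ : (fun t => (bound t)%:E) = (EFin \o cst (sigma ^+ 2)%R) \+
    (fun t => (eta ^+ 2)%:E * (dot (y t - xs) (y t - xs))%:E)); last first.
  by apply/funext => t.
rewrite (integralD measurableT (iconst _) (integrableZl measurableT _ iYY)).
have -> : \int[P]_t (EFin \o cst (sigma ^+ 2)%R) t = (sigma ^+ 2)%:E.
  by rewrite -(expectation_cst P) unlock.
rewrite integralZl//.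
rewrite -(fineK (integrable_fin_num measurableT inn)).
rewrite -(fineK (integrable_fin_num measurableT iYY)).
rewrite -!EFinM -!EFinD !lee_fin.
move: (fine _) (fine _) => N M NM.
have h1 := ler_wpM2l c_ge0 NM.
(* c <= 61 alpha / 60 <= 2 alpha, the source of the factor 2 in the additive noise term. *)
have h2 : (c * sigma ^+ 2 <= 2 * alpha * sigma ^+ 2)%R.
  by rewrite ler_wpM2r ?sqr_ge0//; have := alpha0; lra.
lra.
Qed.

End one_step_integrable.

Lemma expected_step :
  'E_P[fun t => V (col_mx (y t - alpha *: g (y t, w t)) (usubmx (xi t)))] <=
  (1 - s / 3)%:E * 'E_P[fun t => V (xi t)] + (2 * sigma ^+ 2 * alpha)%:E.
Proof.
rewrite unlock.
have V0 t : (0 <= V (xi t))%R by exact: (potential_ge0 mu0 muL hf hxs alpha0).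
have [fin|] := ltP (\int[P]_t (V (xi t))%:E) +oo.
  apply: expected_step_integrable; apply/integrableP; split.
    exact/measurable_EFinP/measurable_potential.
  by under eq_integral do rewrite gee0_abs ?lee_fin//.
(* An infinite expected potential makes the right side infinite, because 1 - s/3 > 0. *)
rewrite leye_eq => /eqP ->; rewrite gt0_muley ?addye ?leey// lte_fin.
by have := s_half; lra.
Qed.

End one_step.

(** * Consequences of the step-size condition *)

Section step_size.
Context {R : realType} {mu L eta alpha : R}.
Hypotheses (mu0 : 0 < mu) (muL : mu <= L) (kappa : 4 <= L / mu).
Hypotheses (alpha0 : 0 < alpha) (halpha : alpha <= alpha_bar mu L eta).
Hypothesis (eta0 : 0 <= eta).

Lemma step_le_inv_L : alpha * L <= 1.
Proof.
have L0 : 0 < L by exact: lt_le_trans muL.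
rewrite -ler_pdivlMr//; apply: (le_trans halpha); rewrite /alpha_bar.
by case: ifP => // _; rewrite ge_min lexx.
Qed.

(** The condition on kappa gives alpha mu <= alpha L / 4 <= 1/4. *)
Lemma sqrt_step_le_half : Num.sqrt (alpha * mu) <= 2^-1.
Proof.
have L0 : 0 < L by exact: lt_le_trans muL.
have h : alpha * mu <= 2^-1 ^+ 2.
  have -> : 2^-1 ^+ 2 = 4^-1 :> R by field.
  have k4 : mu <= 4^-1 * L by move: kappa; rewrite ler_pdivlMr//; lra.
  have := ler_wpM2l (ltW alpha0) k4; have := step_le_inv_L; lra.
rewrite -(@ger0_norm _ (2^-1)) ?invr_ge0// -sqrtr_sqr.
by rewrite ler_sqrt// sqr_ge0.
Qed.

(** After squaring, the claim for eta > 0 is alpha times the second bound in [alpha_bar], with 3600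
    = 60^2; for eta = 0 the left side vanishes. *)
Lemma step_noise_le : alpha * eta ^+ 2 <= Num.sqrt (alpha * mu) * mu / 60.
Proof.
have am : 0 <= alpha * mu by rewrite mulr_ge0 ?ltW.
have rhs0 : 0 <= Num.sqrt (alpha * mu) * mu / 60.
  by apply: divr_ge0 => //; apply: mulr_ge0; [exact: sqrtr_ge0|exact: ltW].
have [e0|] := ltP 0 eta; last first.
  move=> e1; have -> : eta = 0 by apply/le_anti; rewrite e1 eta0.
  by rewrite expr0n mulr0.
have e2 : 0 < (60 * eta ^+ 2) ^+ 2 by rewrite !exprn_gt0// mulr_gt0// exprn_gt0.
have h : alpha * (60 * eta ^+ 2) ^+ 2 <= mu ^+ 3.
  rewrite -ler_pdivlMr//; apply: (le_trans halpha); rewrite /alpha_bar e0.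
  by rewrite ge_min lexx orbT.
have ae0 : 0 <= alpha * eta ^+ 2 by rewrite mulr_ge0 ?sqr_ge0 ?ltW.
rewrite -(@ler_pXn2r _ 2)//.
have -> : (Num.sqrt (alpha * mu) * mu / 60) ^+ 2 = alpha * mu ^+ 3 / 3600.
  by rewrite !exprMn sqr_sqrtr//; field.
have := ler_wpM2l (ltW alpha0) h.
by rewrite !exprMn; lra.
Qed.

End step_size.

(** * Independence of the current noise from the state *)

Lemma independent_subset {R : realType} {dT : measure_display}
    {T : measurableType dT} (P : probability T R) (F G G' : set (set T)) :
  G' `<=` G -> independent P F G -> independent P F G'.
Proof. by move=> sub h A B FA GB; apply: h => //; exact: sub. Qed.

Section state_past.
Context {R : realType} {d : nat} {dT dW : measure_display}.
Context {T : measurableType dT} {W : measurableType dW}.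
Variables (alpha beta : R) (g : borelV R d * W -> borelV R d).
Variables (x0 xm1 : T -> borelV R d) (w : nat -> T -> W) (k : nat).
Hypothesis mg : measurable_fun setT g.

(** [T] is re-equipped with the sigma-algebra generated by the past; the state is then measurable by
    [measurable_asg_state], which is the claimed inclusion. *)
Lemma state_in_past :
  let xi t := asg_state alpha beta g (x0 t) (xm1 t) (fun j => w j t) k in
  g_sigma_algebra_preimage
    (fun t => (usubmx (xi t), dsubmx (xi t)) : borelV R d * borelV R d)
  `<=` past x0 xm1 w k.
Proof.
move=> xi.
pose G := g_sigma_algebra_preimage x0 `|` g_sigma_algebra_preimage xm1 `|`
      \bigcup_(j in `I_k) g_sigma_algebra_preimage (w j).
have gen dS (S : measurableType dS) (h : T -> S) :
    g_sigma_algebra_preimage h `<=` G ->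
    measurable_fun [set: g_sigma_algebraType G] (h : g_sigma_algebraType G -> S).
  move=> hG _ D mD; rewrite setTI; apply: sub_sigma_algebra; apply: hG.
  by exists D => //; rewrite setTI.
have [||j jk|mu md] := @measurable_asg_state R d _ (g_sigma_algebraType G) dW W
    alpha beta g x0 xm1 w k mg.
- by apply: gen => B hB; left; left.
- by apply: gen => B hB; left; right.
- by apply: gen => B hB; right; exists j.
move=> _ [D mD <-]; exact: (measurable_fun_pair mu md) measurableT D mD.
Qed.

End state_past.

(** * Contraction in expectation for the ASG iterates *)

Theorem theoremK1
  (R : realType) (d : nat)
  (mu L : R) (hmu : 0 < mu) (hmuL : mu <= L) (hkappa : 4 <= L / mu)
  (f : 'cV[R]_d -> R) (hf : smooth_strongly_convex mu L f)
  (xs : 'cV[R]_d) (hxs : unique_minimizer f xs)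
  (sigma eta : R) (hsigma : 0 <= sigma) (heta : 0 <= eta)
  (alpha : R) (halpha0 : 0 < alpha) (halpha : alpha <= alpha_bar mu L eta)
  (beta : R) (hbeta : beta = momentum alpha mu)
  (dT : measure_display) (T : measurableType dT) (P : probability T R)
  (dW : measure_display) (W : measurableType dW)
  (g : borelV R d * W -> borelV R d) (hg : measurable_fun setT g)
  (x0 xm1 : {RV P >-> borelV R d}) (w : nat -> {RV P >-> W})
  (hx0 : finite_second_moment P x0) (hxm1 : finite_second_moment P xm1)
  (hindep : forall k : nat,
     independent P (g_sigma_algebra_preimage (w k)) (past x0 xm1 w k))
  (xi : nat -> T -> 'cV[R]_(d + d))
  (hxi : forall k t,
     xi k t = asg_state alpha beta g (x0 t) (xm1 t) (fun j => w j t) k)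
  (y : nat -> T -> 'cV[R]_d)
  (hy : forall k t, y k t = extrapolate beta (xi k t))
  (hnoise : forall k : nat,
     noise_model P f xs sigma eta (y k) (fun t => g (y k t, w k t))) :
  forall k : nat,
    ('E_P[fun t => lyapunov (Qmx d alpha beta mu eta) f xs (xi k.+1 t)] <=
     (1 - Num.sqrt (alpha * mu) / 3)%:E *
       'E_P[fun t => lyapunov (Qmx d alpha beta mu eta) f xs (xi k t)] +
     (2 * sigma ^+ 2 * alpha)%:E)%E.
Proof.
move=> k.
set s := Num.sqrt (alpha * mu).
have am : 0 < alpha * mu by rewrite mulr_gt0.
have s0 : 0 < s by rewrite sqrtr_gt0.
have s2 : s ^+ 2 = alpha * mu by rewrite sqr_sqrtr// ltW.
have s_half : s <= 2^-1 by exact: (sqrt_step_le_half hmu hmuL hkappa halpha0 halpha).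
have aL := step_le_inv_L hmu hmuL halpha.
have ae : alpha * eta ^+ 2 <= s * mu / 60 by exact: step_noise_le halpha _.
have bE : beta = (1 - s) / (1 + s) by [].
have VE z : lyapunov (Qmx d alpha beta mu eta) f xs z =
    @potential R d f xs eta alpha s beta z by exact: lyapunovE.
have hyk : y k = (fun t => extrapolate beta (xi k t)) by apply/funext => t.
have xiS t : xi k.+1 t =
    col_mx (extrapolate beta (xi k t) -
            alpha *: g (extrapolate beta (xi k t), w k t)) (usubmx (xi k t)).
  by rewrite !hxi.
have := hnoise k; rewrite hyk => noise.
have xiE : xi k = fun t => asg_state alpha beta g (x0 t) (xm1 t) (fun j => w j t) k.
  by apply/funext => t.
have [mu_ md] : measurable_fun [set: T] (fun t => usubmx (xi k t) : borelV R d) /\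
    measurable_fun [set: T] (fun t => dsubmx (xi k t) : borelV R d).
  rewrite xiE; exact: (measurable_asg_state _ _ _ _ _ _ k hg (measurable_funP x0)
    (measurable_funP xm1) (fun j _ => measurable_funP (w j))).
have ind : independent P (g_sigma_algebra_preimage (w k))
    (g_sigma_algebra_preimage (fun t => (usubmx (xi k t), dsubmx (xi k t))
       : borelV R d * borelV R d)).
  rewrite xiE; apply: independent_subset (hindep k); exact: state_in_past.
under [X in (expectation _ X <= _)%E]eq_fun do rewrite VE xiS.
under [X in (_ <= _ * expectation _ X + _)%E]eq_fun do rewrite VE.
apply: (expected_step hmu hmuL hf hxs halpha0 s0 s_half s2 aL ae bE hg _ _ mu_ md ind noise).
Qed.
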